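(* Let $k$ and $c$ be positive integers, and let $f(k,c) = 8k^{2}c + 10kc - 4k + 2c + 1$. Let $G$ be a finite simple graph of order $n \ge f(k,c)$. If $\sigma_{2}(G) \ge n$, then $G$ can be partitioned into $k$ $c$-chorded cycles, i.e., $G$ contains $k$ pairwise vertex-disjoint $c$-chorded cycles $C_{1},\dots,C_{k}$ with $\bigcup_{p=1}^{k} V(C_{p}) = V(G)$.
   Context: For a graph $G$, $\sigma_{2}(G)$ denotes the minimum of $d_{G}(u)+d_{G}(v)$ over all pairs of distinct non-adjacent vertices $u,v$ of $G$; if $G$ is complete, $\sigma_{2}(G)=+\infty$. For an integer $c \ge 1$, a cycle $C$ in $G$ is a $c$-chorded cycle if $|E(G[V(C)]) \setminus E(C)| \ge c$, where $G[X]$ is the subgraph induced by $X$; edges of $E(G[V(C)]) \setminus E(C)$ are called chords of $C$. *)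

(* Defs.v *)
From mathcomp Require Import all_boot.
Set Implicit Arguments. Unset Strict Implicit. Unset Printing Implicit Defensive.

Definition simple_graph (T : finType) (e : rel T) : Prop :=
  symmetric e /\ irreflexive e.

Definition deg (T : finType) (e : rel T) (x : T) : nat := #|[set y | e x y]|.

(* sigma_2(G) >= m  (vacuous if G is complete, as sigma_2 = +oo then) *)
Definition sigma2_ge (T : finType) (e : rel T) (m : nat) : Prop :=
  forall u v : T, u != v -> ~~ e u v -> m <= deg e u + deg e v.

Definition is_cycle (T : finType) (e : rel T) (s : seq T) : bool :=
  [&& 3 <= size s, uniq s & cycle e s].

Definition cycle_edges (T : finType) (s : seq T) : {set {set T}} :=
  [set [set x; next s x] | x in s].

Definition induced_edges (T : finType) (e : rel T) (s : seq T) : {set {set T}} :=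
  [set [set x; y] | x in s, y in s & e x y].

Definition chords (T : finType) (e : rel T) (s : seq T) : {set {set T}} :=
  induced_edges e s :\: cycle_edges s.

Definition c_chorded_cycle (T : finType) (e : rel T) (c : nat) (s : seq T) : Prop :=
  is_cycle e s /\ c <= #|chords e s|.

Definition f (k c : nat) : nat := 8 * k ^ 2 * c + 10 * k * c - 4 * k + 2 * c + 1.

(* Main.v *)
Require Import Defs.
From mathcomp Require Import all_boot.
From mathcomp Require Import zify.
From Stdlib Require Import Classical.
Set Implicit Arguments. Unset Strict Implicit. Unset Printing Implicit Defensive.

(** Some [k] disjoint [c]-chorded cycles exist, because a shortest [c]-chorded
    cycle in a dense graph is short. Take [k] disjoint [c]-chorded cycles that
    cover as many vertices as possible, let [L] be the covered set and suppose
    that the set [H] of the remaining vertices is not empty. A vertex of [H]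
    that is adjacent to two consecutive vertices of a cycle could be inserted,
    so it sends at most [|L|/2] edges to [L]; hence the induced graph on [H]
    satisfies Ore's condition, and any two of its vertices are joined by a path
    in [H].
    Call a vertex of [L] attached if it has a neighbour in [H]. By the same
    insertion argument no two consecutive vertices are attached, and a
    non-attached vertex [w] has so many neighbours in [L] that it can usually
    be moved to another cycle that has attached vertices. Moving such vertices
    away one by one shows first that a vertex of [H] has at most [c + 1]
    neighbours on every cycle, so that non-attached vertices are adjacent to all
    but fewer than [K = k (c + 1)] vertices of [L].
    It follows that every part has fewer than [3 K + c] vertices: a longer cycle
    with attached vertices can be split and merged with a second one so as to
    cover more vertices; a longer cycle without attached vertices can be
    shortened in favour of the others, which an extremal choice excludes; and if
    [H] is that large, then its Hamiltonian cycle (Ore) can replace a cycle.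
    Summing over the [k + 1] parts contradicts the lower bound on the order. *)

(** * Extremal elements and sequences *)

(* [lia] is slow in a large context, and it identifies atoms syntactically, so
   that the two spellings of the carrier of a [finType] must be unified first. *)
Ltac flia :=
  repeat match goal with H : ?P |- _ =>
    lazymatch P with
    | is_true (leq _ _) => fail
    | _ = _ :> nat => fail
    | _ => clear H
    end end;
  try match goal with T : finType |- _ =>
    change (Equality.sort T) with (Finite.sort T) in * end;
  lia.

Section Extremal.
Variables (A : Type) (P : A -> Prop) (m : A -> nat).

Lemma exists_max (b : nat) (x0 : A) :
  P x0 -> (forall x, P x -> m x <= b) ->
  exists2 x, P x & forall y, P y -> m y <= m x.
Proof.
elim: b x0 => [|b IH] x0 Px0 le_b.
  by exists x0 => // y /le_b; rewrite leqn0 => /eqP->.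
have [[x [Px mx]]|no_x] := classic (exists x, P x /\ m x = b.+1).
  by exists x => // y /le_b; rewrite mx.
apply: (IH x0 Px0) => x Px; have := le_b x Px.
rewrite leq_eqVlt => /orP[/eqP mx|//]; case: no_x; by exists x.
Qed.

End Extremal.

Lemma exists_min (A : Type) (P : A -> Prop) (m : A -> nat) (b : nat) (x0 : A) :
  P x0 -> (forall x, P x -> m x <= b) ->
  exists2 x, P x & forall y, P y -> m x <= m y.
Proof.
move=> Px0 le_b.
have [|x Px max_x] := @exists_max A P (fun x => b - m x) b x0 Px0.
  by move=> x _; apply: leq_subr.
exists x => // y Py; move: (max_x y Py) (le_b y Py) (le_b x Px); lia.
Qed.

Section Sequences.
Variable T : eqType.
Implicit Types (x y : T) (s : seq T).

Lemma path_break (r : rel T) x s : ~~ path r x s ->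
  exists s1 y s2, s = s1 ++ y :: s2 /\ ~~ r (last x s1) y.
Proof.
elim: s x => //= y s IH x; rewrite negb_and; case: (boolP (r x y)) => [_ /=|nr _].
  by case/IH=> s1 [z [s2 [-> nr]]]; exists (y :: s1), z, s2.
by exists [::], y, s.
Qed.

Lemma cycle_break (r : rel T) s : ~~ cycle r s ->
  exists i x s', rot i s = x :: s' /\ ~~ r (last x s') x.
Proof.
case: s => //= x s /path_break[s1 [y [s2 [def_s nr]]]].
case/lastP: s2 def_s => [|s2 z].
  rewrite cats1 => /rcons_inj[def_s def_y]; subst s1 y.
  by exists 0, x, s; rewrite rot0.
rewrite -rcons_cons -rcons_cat => /rcons_inj[-> _].
exists (size (x :: s1)), y, (s2 ++ x :: s1).
by rewrite -cat_cons rot_size_cat last_cat.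
Qed.

(** The successors of [a]-vertices are never [b]-vertices, which gives two disjoint sets of
    positions in [s]. *)
Lemma path_count (a b : pred T) x s :
  path (fun x y => ~~ (a x && b y)) x s ->
  count a (belast x s) + count b s <= size s.
Proof. by elim: s x => //= y s IH x /andP[nab /IH]; case: (a x) (b y) nab => [] [] //=; lia. Qed.

Lemma cycle_count (a b : pred T) s :
  cycle (fun x y => ~~ (a x && b y)) s -> count a s + count b s <= size s.
Proof.
case: s => // x s /path_count.
by rewrite belast_rcons size_rcons -cats1 count_cat /= addn0 [count b s + _]addnC.
Qed.

(** Otherwise [path_count] applies, although each of its two counts falls short of the number of
    steps by at most [n], less than half of that number. *)
Lemma adjacent_pair (a b : pred T) n s :
  count (predC a) s <= n -> count (predC b) s <= n -> n.*2.+2 <= size s ->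
  exists s1 x y s2, [/\ s = s1 ++ x :: y :: s2, a x & b y].
Proof.
case: s => // x s na nb le_n.
have [ok|] := boolP (path (fun x y => ~~ (a x && b y)) x s).
  have := path_count ok; have := count_predC a (belast x s).
  have := count_predC b s; rewrite size_belast.
  move: na; rewrite {1}lastI -cats1 count_cat; move: nb le_n => /=; lia.
case/path_break=> s1 [y [s2 [-> /negPn/andP[al bl]]]].
exists (belast x s1), (last x s1), y, s2; split=> //.
by rewrite -[RHS]cat_rcons -lastI.
Qed.

Lemma sumn_le m (g : T -> nat) s : {in s, forall x, g x <= m} ->
  sumn (map g s) <= size s * m.
Proof.
elim: s => //= x s IH le_m; rewrite mulSn leq_add ?le_m ?mem_head // IH // => y ys.
by rewrite le_m // inE ys orbT.
Qed.

Lemma sumn_ge m (g : T -> nat) s : {in s, forall x, m <= g x} ->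
  size s * m <= sumn (map g s).
Proof.
elim: s => //= x s IH le_m; rewrite mulSn leq_add ?le_m ?mem_head // IH // => y ys.
by rewrite le_m // inE ys orbT.
Qed.

Lemma subset_count (a : pred T) s t :
  uniq s -> {in s, forall x, a x -> x \in t} -> count a s <= count a t.
Proof.
move=> us st; rewrite -!size_filter; apply: uniq_leq_size; first exact: filter_uniq.
by move=> x; rewrite !mem_filter => /andP[ax xs]; rewrite ax st.
Qed.

Lemma count_irr (e : rel T) x s : irreflexive e -> x \in s ->
  count (e x) s < size s.
Proof.
move=> irr xs; rewrite -(count_predC (e x)) -[ltnLHS]addn0 ltn_add2l -has_count.
by apply/hasP; exists x; rewrite //= irr.
Qed.

End Sequences.

(** * Counting chords *)

Section Chords.
Variables (T : finType) (e : rel T).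
Implicit Types (s t : seq T).

Lemma next_next s x : uniq s -> 3 <= size s -> x \in s -> next s (next s x) != x.
Proof.
move=> us ss xs; have [i s' def_s] := rot_to xs.
rewrite -!(next_rot i us) def_s.
have := us; rewrite -(rot_uniq i) def_s; have := ss; rewrite -(size_rot i) def_s.
case: s' {def_s} => [|y [|z s']] //= _; rewrite !inE !negb_or eqxx => /and3P[/and3P[xy xz _] _ _].
by rewrite /= eqxx [y == x]eq_sym (negbTE xy) eq_sym.
Qed.

Lemma set2_eq (x y x' y' : T) :
  [set x; y] = [set x'; y'] -> (x = x' /\ y = y') \/ (x = y' /\ y = x').
Proof.
move=> eq2.
have /set2P x_in : x \in [set x'; y'] by rewrite -eq2 set21.
have /set2P y_in : y \in [set x'; y'] by rewrite -eq2 set22.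
have /set2P x'_in : x' \in [set x; y] by rewrite eq2 set21.
have /set2P y'_in : y' \in [set x; y] by rewrite eq2 set22.
case: x_in y_in x'_in y'_in => ? [] ? [] ? [] ?;
  by [left; split; congruence | right; split; congruence].
Qed.

Lemma cycle_edge_inj s : uniq s -> 3 <= size s ->
  {in s &, injective (fun x => [set x; next s x])}.
Proof.
move=> us ss x y xs ys /set2_eq[[]//|[xy yx]].
by have := next_next us ss xs; rewrite yx -xy eqxx.
Qed.

Lemma card_cycle_edges s : uniq s -> 3 <= size s -> #|cycle_edges s| = size s.
Proof. by move=> us ss; rewrite card_in_imset ?(card_uniqP us) //; apply: cycle_edge_inj. Qed.

Lemma mem_induced s x y : x \in s -> y \in s -> e x y ->
  [set x; y] \in induced_edges e s.
Proof. by move=> xs ys exy; apply/imset2P; exists x y; rewrite ?inE ?ys. Qed.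

Lemma cycle_edges_sub s : is_cycle e s -> cycle_edges s \subset induced_edges e s.
Proof.
case/and3P=> _ us cs; apply/subsetP=> _ /imsetP[x xs ->].
by apply: mem_induced; rewrite ?mem_next //; apply: next_cycle.
Qed.

Lemma chords_induced s : is_cycle e s ->
  #|chords e s| + size s = #|induced_edges e s|.
Proof.
move=> cs; have /and3P[ss us _] := cs.
by rewrite cardsDS ?cycle_edges_sub // card_cycle_edges // subnK //
  -(card_cycle_edges us ss) subset_leq_card ?cycle_edges_sub.
Qed.

(* Every vertex of [t] outside [s] contributes the edge to its successor in
   [t], which compensates for the growth of the cycle. *)
Lemma chords_mono s t : is_cycle e s -> is_cycle e t -> {subset s <= t} ->
  #|chords e s| <= #|chords e t|.
Proof.
move=> cs ct st; have /and3P[ss us _] := cs; have /and3P[sst ut cct] := ct.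
rewrite -(leq_add2r (size t)) (chords_induced ct).
set new := [set [set x; next t x] | x in [seq x <- t | x \notin s]].
have card_new : #|new| + size s = size t.
  rewrite card_in_imset; last first.
    move=> x y; rewrite !mem_filter => /andP[_ xt] /andP[_ yt].
    exact: (cycle_edge_inj ut sst).
  rewrite (card_uniqP _) ?filter_uniq // size_filter.
  rewrite -[RHS](count_predC (mem s) t) addnC; congr (_ + _).
  rewrite -size_filter; apply/perm_size/uniq_perm; rewrite ?filter_uniq //.
  move=> x; rewrite mem_filter /=; apply/idP/andP=> [xs|[]//]; split=> //; exact: st.
have dis : [disjoint induced_edges e s & new].
  rewrite disjoint_subset; apply/subsetP=> E /imset2P[x y xs]; rewrite inE => /andP[ys _] ->.
  rewrite inE; apply/negP=> /imsetP[z]; rewrite mem_filter => /andP[zs _] /set2_eq[[xz _]|[_ yz]].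
    by rewrite -xz xs in zs.
  by rewrite -yz ys in zs.
have : #|induced_edges e s :|: new| <= #|induced_edges e t|.
  apply/subset_leq_card/subsetP=> E /setUP[/imset2P[x y xs]|/imsetP[x]].
    by rewrite inE => /andP[/st ys exy] ->; apply: mem_induced => //; apply: st.
  rewrite mem_filter => /andP[_ xt] ->; apply: mem_induced; rewrite ?mem_next //.
  exact: next_cycle.
by rewrite cardsU disjoint_setI0 // cards0 subn0 -(chords_induced cs) -addnA
  [size s + _]addnC card_new.
Qed.

(** At most two neighbours of [v] are next to it on the cycle; each of the others yields its own
    chord at [v]. *)
Lemma chords_deg c s v : is_cycle e s -> v \in s -> c + 2 <= count (e v) s ->
  c <= #|chords e s|.
Proof.
move=> cs vs dv; have /and3P[ss us _] := cs.
set N := [seq u <- s | e v u & (u != next s v) && (u != prev s v)].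
have cN : c <= size N.
  have : count (e v) s <= size N + 2.
    rewrite size_filter; move: (next s v) (prev s v) => y z.
    have : count (e v) s <= count (fun u => e v u && ((u != y) && (u != z))) s
                            + (count_mem y s + count_mem z s).
      elim: (s) => //= u s' IH.
      by case: (e v u); case: (u == y); case: (u == z) => /=; lia.
    by rewrite !count_uniq_mem //; case: (_ \in s); case: (_ \in s) => /=; lia.
  lia.
apply: (leq_trans cN); rewrite -(card_uniqP (filter_uniq _ us)).
rewrite -(@card_in_imset _ _ (fun u => [set v; u])); last first.
  by move=> x y; rewrite !mem_filter => /andP[/andP[evx _] _] _ /set2_eq[[]//|[vy]] ->.
apply/subset_leq_card/subsetP=> E /imsetP[u]; rewrite mem_filter.
case/andP=> /and3P[evu unx upv] us' ->; rewrite inE mem_induced // andbT.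
apply/negP=> /imsetP[x xs] /set2_eq[[vx ux]|[vx ux]].
  by rewrite ux vx eqxx in unx.
by rewrite ux vx prev_next ?eqxx in upv.
Qed.

End Chords.

(** * Ore's theorem and short chorded cycles *)

Section Paths.
Variables (T : finType) (e : rel T).
Hypotheses (e_sym : symmetric e) (e_irr : irreflexive e).
Implicit Types (s t W : seq T).

Lemma cycle_consE x s : cycle e (x :: s) = path e x s && e (last x s) x.
Proof. by rewrite /= rcons_path. Qed.

Lemma rev_consE x s : rev (x :: s) = last x s :: rev (belast x s).
Proof. by rewrite lastI rev_rcons. Qed.

Lemma path_rev x s : path e (last x s) (rev (belast x s)) = path e x s.
Proof. by rewrite rev_path; apply: eq_path => y z; rewrite e_sym. Qed.

Lemma last_rev_belast x s : last (last x s) (rev (belast x s)) = x.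
Proof. by rewrite -(last_cons x) -rev_consE rev_cons last_rcons. Qed.

Lemma rot_path i s x s' : cycle e s -> rot i s = x :: s' -> path e x s' /\ e (last x s') x.
Proof. by move=> cs def_s; move: cs; rewrite -(rot_cycle i) def_s cycle_consE => /andP. Qed.

(** Run from [w] to [q], through [r] to the end of the path, backwards to [q'], and home along the
    edge from [q'] to [w]. *)
Lemma cross_cycle w s s1 q q' s2 r :
  path e w s -> w :: s = s1 ++ q :: q' :: s2 -> path e q (rcons r (last w s)) ->
  e w q' -> cycle e (s1 ++ q :: r ++ rev (q' :: s2)).
Proof.
move=> ps def_s pr wq'; rewrite rev_consE.
have last_s : last w s = last q' s2.
  by rewrite -(last_cons w w) def_s last_cat.
move: pr; rewrite last_s rcons_path => /andP[pr er].
case: s1 def_s => [[def_w def_s]|w' s1 [def_w def_s]]; subst.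
  move: ps => /= /andP[_ ps]; rewrite rcons_path cat_path last_cat /= pr er path_rev ps.
  by rewrite last_rev_belast e_sym.
move: ps; rewrite cat_path => /= /and4P[ps1 eq _ ps2].
rewrite rcons_path !cat_path last_cat /= last_cat cat_path /= ps1 eq pr er path_rev ps2.
by rewrite last_rev_belast e_sym.
Qed.

Lemma longest_path W a : a \in W ->
  exists u p, [/\ uniq (u :: p), {subset u :: p <= W}, path e u p &
    forall u' p', uniq (u' :: p') -> {subset u' :: p' <= W} -> path e u' p' ->
      size p' <= size p].
Proof.
move=> aW.
pose P (q : T * seq T) := [/\ uniq (q.1 :: q.2), {subset q.1 :: q.2 <= W} & path e q.1 q.2].
have [||[u p] [up pW pp] pmax] := @exists_max _ P (fun q => size q.2) (size W) (a, [::]).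
- by split=> // x; rewrite inE => /eqP->.
- by move=> [u p] [up pW _]; apply: (leq_trans (leqnSn _)); apply: (uniq_leq_size up).
by exists u, p; split=> // u' p' *; apply: (pmax (u', p')).
Qed.

Lemma extend_path W u p a : uniq (u :: p) -> {subset u :: p <= W} -> path e u p ->
  (forall u' p', uniq (u' :: p') -> {subset u' :: p' <= W} -> path e u' p' ->
      size p' <= size p) -> a \in W -> e a u -> a \in u :: p.
Proof.
move=> up pW pp pmax aW eau; apply/negPn/negP=> anp.
suff: size (u :: p) <= size p by rewrite ltnn.
apply: (pmax a); rewrite ?cons_uniq ?anp //=; last by rewrite eau.
by move=> x; rewrite inE => /predU1P[->//|/pW].
Qed.

(** A longest path closes up to a cycle by crossing edges; a vertex off it would then either
    lengthen the path or violate the degree condition. *)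
Lemma ore_hamilton W : uniq W -> 3 <= size W ->
  {in W &, forall u v, u != v -> ~~ e u v -> size W <= count (e u) W + count (e v) W} ->
  exists2 t, is_cycle e t & perm_eq t W.
Proof.
move=> uW sW ore.
have [a aW] : exists a, a \in W by case: W sW {uW ore} => // a; exists a; rewrite mem_head.
have [u [p [up pW pp pmax]]] := longest_path aW.
have nbr_u x : x \in W -> e x u -> x \in u :: p by apply: extend_path.
have uWin : u \in W by apply: pW; rewrite mem_head.
have vp : last u p \in u :: p by apply: mem_last.
have le_u : count (e u) W <= count (e u) p.
  have -> : count (e u) p = count (e u) (u :: p) by rewrite /= e_irr.
  by apply: subset_count => // x xW; rewrite e_sym; apply: nbr_u.
have le_v : count (e (last u p)) W <= count (e (last u p)) (belast u p).
  have -> : count (e (last u p)) (belast u p) = count (e (last u p)) (u :: p).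
    by rewrite [in RHS]lastI -cats1 count_cat /= e_irr !addn0.
  apply: subset_count => // x xW exv; rewrite -mem_rev rev_consE.
  apply: (@extend_path W) => //; rewrite ?path_rev -?rev_consE ?rev_uniq //.
  - by move=> y; rewrite mem_rev; apply: pW.
  - by move=> u' p' *; rewrite size_rev size_belast; apply: (pmax u').
  - by rewrite e_sym.
have cyc : p = [::] \/ exists2 t, cycle e t & perm_eq t (u :: p).
  have [def_v|nuv] := eqVneq u (last u p).
    left; case: (p) def_v up => // x s /= def_v; by rewrite {1}def_v mem_last.
  right; have [euv|neuv] := boolP (e u (last u p)).
    by exists (u :: p); rewrite // cycle_consE pp e_sym.
  have : ~~ path (fun x y => ~~ (e (last u p) x && e u y)) u p.
    apply/negP=> /(@path_count _ (e (last u p)) (e u)); apply/negP; rewrite -ltnNge.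
    have : size p < size W by apply: (uniq_leq_size up).
    move: (ore _ _ uWin (pW _ vp) nuv neuv). flia.
  case/path_break=> s1 [y [s2 [def_p /negPn/andP[elx euy]]]].
  have def_up : u :: p = belast u s1 ++ last u s1 :: y :: s2.
    by rewrite -[RHS]cat_rcons -lastI def_p.
  exists (belast u s1 ++ last u s1 :: [::] ++ rev (y :: s2)).
    by apply: (cross_cycle pp); rewrite //= e_sym elx.
  by rewrite def_up perm_cat2l perm_cons /= perm_rev.
have far a' x : a' \in W -> a' \notin u :: p -> x \in u :: p -> ~~ e a' x.
  move=> a'W a'p xp; apply: contra a'p => ea'x.
  case: cyc => [p0|[t ct tp]].
    by move: xp; rewrite p0 inE => /eqP xu; rewrite -p0 nbr_u -?xu.
  have xt : x \in t by rewrite (perm_mem tp).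
  have [i s' def_s] := rot_to xt.
  have [ps' _] := rot_path ct def_s.
  have sp : perm_eq (x :: s') (u :: p) by rewrite -def_s perm_rot.
  rewrite -(perm_mem sp); apply: (@extend_path W) => //.
  - by rewrite (perm_uniq sp).
  - by move=> y; rewrite (perm_mem sp); apply: pW.
  - have sz : size s' = size p := eq_add_S _ _ (perm_size sp).
    by move=> u' p' *; rewrite sz; apply: (pmax u').
have subW : {subset W <= u :: p}.
  move=> a' a'W; apply/negPn/negP=> a'p.
  have nua' : u != a' by apply: contraNneq a'p => <-; rewrite mem_head.
  have neua' : ~~ e u a' by rewrite e_sym far ?mem_head.
  have := ore u a' uWin a'W nua' neua'; apply/negP; rewrite -ltnNge.
  (* All neighbours of [a'] lie in [F] and those of [u] on the path; without loops the two counts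
     sum to less than [size W]. *)
  set F := [seq x <- W | x \notin u :: p].
  have sF : size F + size (u :: p) = size W.
    rewrite -size_cat; apply/perm_size/uniq_perm => //.
      rewrite cat_uniq filter_uniq // up andbT; apply/hasPn=> x xp.
      by rewrite mem_filter xp.
    move=> x; rewrite mem_cat mem_filter; case: (boolP (x \in u :: p)) => [/pW->|] //.
    by rewrite orbF.
  have a'F : a' \in F by rewrite mem_filter a'p.
  have cF : count (e a') W <= count (e a') F.
    apply: subset_count => // x xW ea'x; rewrite mem_filter xW andbT.
    by apply: contraL ea'x; apply: far.
  have := count_irr e_irr a'F; have := count_size (e u) p.
  by move: sF cF le_u; rewrite /=; flia.
have pWp : perm_eq (u :: p) W.
  by apply: uniq_perm => // x; apply/idP/idP; [apply: pW|apply: subW].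
case: cyc => [p0|[t ct tp]]; first by move: sW; rewrite -(perm_size pWp) p0.
have tW := perm_trans tp pWp.
by exists t => //; rewrite /is_cycle (perm_size tW) (perm_uniq tW) sW uW.
Qed.

(* Trimming [p] at both ends until it starts and ends in neighbours of [v] and
   contains exactly [c + 2] of them. *)
Lemma fan_cycle c v p : 0 < c -> uniq (v :: p) -> sorted e p -> c + 2 <= count (e v) p ->
  exists t, [/\ c_chorded_cycle e c t, {subset t <= v :: p} &
    size t + count (e v) p <= size p + c + 3].
Proof.
move=> c_gt0; have [n] := ubnP (size p); elim: n p => // n IH p sp up pp cp.
case: p sp up pp cp => [|a p] sp up pp cp; first by rewrite /= in cp; flia.
have [shrink|] := boolP ((c + 2 < count (e v) (a :: p)) || ~~ e v a).
  have [||||t [ct tp st]] := IH p.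
  - by rewrite /= in sp; flia.
  - by move: up; rewrite /= inE negb_or => /andP[/andP[_ ->] /andP[_ ->]].
  - exact: path_sorted pp.
  - by move: shrink cp; rewrite /=; case: (e v a) => /=; flia.
  exists t; split=> // [x /tp|]; first by rewrite !inE => /orP[]->; rewrite ?orbT.
  by move: st; rewrite /=; case: (e v a) => /=; flia.
rewrite negb_or -leqNgt negbK => /andP[le_c eva].
have [ez|nez] := boolP (e v (last a p)).
  exists (v :: a :: p); split=> //; last first.
    by move: le_c; rewrite /=; flia.
  have ct : is_cycle e (v :: a :: p).
    apply/and3P; split=> //; last by rewrite cycle_consE /= eva e_sym ez andbT.
    by have := count_size (e v) (a :: p); rewrite /= in cp *; flia.
  split=> //; apply: (chords_deg ct (v := v)); rewrite ?mem_head //.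
  by rewrite /= e_irr.
case/lastP: p nez sp up pp cp le_c {IH} (IH) => [|p z]; first by rewrite /= eva.
rewrite last_rcons -!rcons_cons => nez sp up pp cp le_c IH.
have cz : count (e v) (rcons (a :: p) z) = count (e v) (a :: p).
  by rewrite -cats1 count_cat /= (negbTE nez) !addn0.
have [||||t [ct tp st]] := IH (a :: p).
- by rewrite size_rcons in sp.
- by move: up; rewrite rcons_uniq => /andP[].
- by move: pp; rewrite /= rcons_path => /andP[].
- by rewrite -cz.
exists t; split=> // [x /tp xin|]; first by rewrite mem_rcons in_cons xin orbT.
by rewrite cz size_rcons; flia.
Qed.

Lemma min_degree_cycle c W a : 0 < c -> uniq W -> a \in W ->
  {in W, forall x, c + 2 <= count (e x) W} ->
  exists2 t, c_chorded_cycle e c t & {subset t <= W}.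
Proof.
move=> c_gt0 unW aW degW.
have [u [p [up pW pp pmax]]] := longest_path aW.
have uW : u \in W by apply: pW; rewrite mem_head.
have le_u : count (e u) W <= count (e u) p.
  have -> : count (e u) p = count (e u) (u :: p) by rewrite /= e_irr.
  by apply: subset_count => // x xW; rewrite e_sym; apply: (extend_path up pW).
have [|t [ct tp _]] := fan_cycle c_gt0 up (path_sorted pp).
  exact: leq_trans (degW u uW) le_u.
by exists t => // x /tp/pW.
Qed.

Lemma double_count s t :
  sumn [seq count (e x) t | x <- s] = sumn [seq count (e y) s | y <- t].
Proof.
rewrite !sumnE !big_map.
under eq_bigr do rewrite -sum1_count big_mkcond.
under [RHS]eq_bigr do rewrite -sum1_count big_mkcond.
rewrite exchange_big /=.
by do 2!(apply: eq_bigr => ? _); rewrite e_sym.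
Qed.

(* In a shortest [c]-chorded cycle no vertex has more than [c + 3] neighbours,
   by [fan_cycle]; double counting then bounds its length. *)
Lemma short_cycle c W a m : 0 < c -> uniq W -> a \in W -> c + 2 <= m ->
  {in W, forall x, m <= count (e x) W} ->
  exists t, [/\ c_chorded_cycle e c t, {subset t <= W} & size t * m <= size W * (c + 3)].
Proof.
move=> c_gt0 unW aW le_m degW.
have [|t0 ct0 t0W] := min_degree_cycle c_gt0 unW aW.
  by move=> x /degW; apply: leq_trans.
pose P t := c_chorded_cycle e c t /\ {subset t <= W}.
have [||t [ct tW] tmin] := @exists_min _ P size (size W) t0; first by [].
  by move=> t [[/and3P[_ ut _] _] tW]; apply: uniq_leq_size.
exists t; split=> //.
have few x : x \in W -> count (e x) t <= c + 3.
  move=> xW; rewrite leqNgt; apply/negP=> gt_x.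
  have [/and3P[st ut cyct] _] := ct.
  (* If [x] lies on [t], the path is [t] opened at [x] with [x] removed, otherwise all of [t];
     either way [fan_cycle] yields a shorter cycle. *)
  have [xt|xt] := boolP (x \in t).
    have [i p def_t] := rot_to xt; have [pp _] := rot_path cyct def_t.
    have pt : perm_eq (x :: p) t by rewrite -def_t perm_rot.
    have cp : count (e x) p = count (e x) t.
      by rewrite -(permP pt) /= e_irr.
    have [||t' [ct' t'p]] := @fan_cycle c x p c_gt0 _ (path_sorted pp).
    - by rewrite (perm_uniq pt).
    - by rewrite cp; flia.
    have sp : (size p).+1 = size t := perm_size pt.
    have t'W : {subset t' <= W} by move=> y /t'p; rewrite (perm_mem pt) => /tW.
    by rewrite cp; move: (tmin t' (conj ct' t'W)); flia.
  have [|||t' [ct' t'p]] := @fan_cycle c x t c_gt0 _ _.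
  - by rewrite /= xt.
  - by case: (t) cyct => //= y s; rewrite rcons_path => /andP[].
  - by flia.
  have t'W : {subset t' <= W} by move=> y /t'p; rewrite inE => /predU1P[->|/tW].
  by move: (tmin t' (conj ct' t'W)); flia.
apply: (leq_trans (sumn_ge (g := fun x => count (e x) W) _)).
  by move=> x /tW/degW.
by rewrite double_count; apply: sumn_le.
Qed.

End Paths.

(** * Disjoint chorded cycles *)

Section DisjointCycles.
Variables (T : finType) (e : rel T).
Hypotheses (e_sym : symmetric e) (e_irr : irreflexive e).
Hypothesis ore : sigma2_ge e #|T|.
Implicit Types (s t U : seq T).

Definition outside U := [seq x <- enum T | x \notin U].

Lemma mem_outside U x : (x \in outside U) = (x \notin U).
Proof. by rewrite mem_filter mem_enum andbT. Qed.

Lemma outside_uniq U : uniq (outside U).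
Proof. by rewrite filter_uniq ?enum_uniq. Qed.

Lemma perm_outside U : uniq U -> perm_eq (U ++ outside U) (enum T).
Proof.
move=> uU; apply: uniq_perm; rewrite ?enum_uniq //.
  rewrite cat_uniq uU outside_uniq andbT; apply/hasPn=> x.
  by rewrite mem_outside.
by move=> x; rewrite mem_cat mem_outside mem_enum orbN.
Qed.

Lemma size_outside U : uniq U -> size U + size (outside U) = #|T|.
Proof. by move=> uU; rewrite -size_cat (perm_size (perm_outside uU)) cardE. Qed.

Lemma deg_split U x : uniq U -> deg e x = count (e x) U + count (e x) (outside U).
Proof.
move=> uU; rewrite -count_cat (permP (perm_outside uU)).
rewrite /deg cardE -size_filter; apply/perm_size/uniq_perm.
- exact: enum_uniq.
- by rewrite filter_uniq ?enum_uniq.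
by move=> y; rewrite mem_enum inE mem_filter mem_enum andbT.
Qed.

Lemma clique_path x s : uniq (x :: s) ->
  {in x :: s &, forall y z, y != z -> e y z} -> path e x s.
Proof.
elim: s x => //= y s IH x /andP[xys uys] adj.
rewrite adj ?inE ?eqxx ?orbT //=; last by apply: contraNneq xys => ->; rewrite mem_head.
by apply: IH => // z w zs ws; apply: adj; rewrite inE ?zs ?ws orbT.
Qed.

Lemma clique_chorded c s : uniq s -> c + 3 <= size s ->
  {in s &, forall y z, y != z -> e y z} -> c_chorded_cycle e c s.
Proof.
case: s => [|x s] us ss adj; first by move: ss => /=; lia.
have cs : is_cycle e (x :: s).
  apply/and3P; split=> //; first by move: ss; lia.
  rewrite cycle_consE clique_path //=.
  case: s us ss adj => [|y s] us ss adj; first by move: ss => /=; lia.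
  apply: adj; rewrite ?mem_head ?mem_last //.
  by apply: contraTneq us => def_x; rewrite cons_uniq -{1}def_x last_cons mem_last.
split=> //; apply: (chords_deg cs (v := x)); rewrite ?mem_head //=.
have : {in s, forall y, e x y}.
  move=> y ys; apply: adj; rewrite ?mem_head ?inE ?ys ?orbT //.
  by apply: contraTneq us => ->; rewrite /= ys.
by move=> /allP; rewrite all_count => /eqP->; move: ss; rewrite e_irr /=; flia.
Qed.

(* The vertices of low degree outside [U] form a clique, so they either contain
   a chorded cycle or may be discarded. *)
Lemma cycle_avoiding c U : 0 < c -> uniq U -> 2 * size U + 4 * c + 8 <= #|T| ->
  exists t, [/\ c_chorded_cycle e c t, {in t, forall x, x \notin U} &
    3 * size U + 4 * c + 8 <= #|T| -> size t <= 4 * c + 12].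
Proof.
(* Two non-adjacent vertices of [W] have at least [N] neighbours in [W] in total, since each has at
   most [size U] in [U]. *)
move=> c_gt0 uU le_n; set W := outside U; pose N := #|T| - 2 * size U.
have sW : size U + size W = #|T| by apply: size_outside.
pose low x := 2 * count (e x) W < N.
pose Low := filter low W.
have adj : {in Low &, forall x y, x != y -> e x y}.
  move=> x y; rewrite !mem_filter => /andP[lx _] /andP[ly _] nxy.
  apply/negPn/negP=> /(ore nxy); rewrite !(deg_split _ uU) -/W.
  have := count_size (e x) U; have := count_size (e y) U.
  by move: lx ly; rewrite /low /N; flia.
have uLow : uniq Low by apply/filter_uniq/outside_uniq.
have [big|small] := leqP (c + 3) (size Low).
  exists (take (c + 3) Low); split.
  - apply: clique_chorded; rewrite ?take_uniq ?size_takel //.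
    by move=> x y /mem_take xL /mem_take yL; apply: adj.
  - by move=> x /mem_take; rewrite mem_filter mem_outside => /andP[].
  - by rewrite size_takel //; flia.
pose H := filter (predC low) W.
have split_W a : count a W = count a Low + count a H.
  by rewrite -count_cat; apply/permP; rewrite perm_sym perm_filterC.
have sH : size W = size Low + size H by rewrite -!count_predT split_W.
(* Half of [N], rounded up, less the at most [c + 2] neighbours lost with [Low]. *)
pose m := uphalf (N - 2 * (c + 2)).
have degH : {in H, forall x, m <= count (e x) H}.
  move=> x; rewrite mem_filter => /andP[/=]; rewrite /low -leqNgt split_W => lx _.
  have := count_size (e x) Low; rewrite /m uphalf_half; move: lx small; flia.
have [a aH] : exists a, a \in H.
  case: (H) sH => [|a s] sH; last by exists a; rewrite mem_head.
  by move: sH small => /=; flia.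
have uH : uniq H by apply/filter_uniq/outside_uniq.
have le_m : c + 2 <= m by rewrite /m /N; flia.
have [t [ct tH st]] := short_cycle e_sym e_irr c_gt0 uH aH le_m degH.
exists t; split=> // [x /tH|le3].
  by rewrite mem_filter mem_outside => /andP[].
(* This turns the bound of [short_cycle] into [4 * (c + 3)]. *)
have le_H : size H <= 4 * m.
  by rewrite /m /N; flia.
have m_gt0 : 0 < m by rewrite /m /N; flia.
rewrite -(leq_pmul2r m_gt0); apply: (leq_trans st).
apply: (@leq_trans (4 * m * (c + 3))); first by rewrite leq_mul2r le_H orbT.
by rewrite -mulnA mulnCA mulnC leq_mul2r; apply/orP; right; lia.
Qed.

Definition packing c (Cs : seq (seq T)) : Prop :=
  (forall C, C \in Cs -> c_chorded_cycle e c C) /\ uniq (flatten Cs).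

Lemma packing_cons c C Cs : c_chorded_cycle e c C -> packing c Cs ->
  {in C, forall x, x \notin flatten Cs} -> packing c (C :: Cs).
Proof.
move=> cC [cCs uCs] dis; split.
  by move=> D; rewrite inE => /predU1P[->|/cCs].
have [/and3P[_ uC _] _] := cC.
rewrite /= cat_uniq uC uCs andbT; apply/hasPn=> x xCs.
by apply: contraL xCs; apply: dis.
Qed.

(** Greedy choice; [j.-1] appears because the last cycle only has to avoid the ones before it. *)
Lemma small_packing c j : 0 < c -> 3 * (j.-1 * (4 * c + 12)) + 4 * c + 8 <= #|T| ->
  exists Cs, [/\ packing c Cs, size Cs = j & size (flatten Cs) <= j * (4 * c + 12)].
Proof.
move=> c_gt0; elim: j => [|j IH] le_n; first by exists [::].
have [|Cs [pCs sCs fCs]] := IH.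
  have : j.-1 * (4 * c + 12) <= j * (4 * c + 12) by rewrite leq_mul2r leq_pred orbT.
  by move: le_n => /=; flia.
have [|t [ct tCs st]] := @cycle_avoiding c (flatten Cs) c_gt0 (proj2 pCs).
  by move: le_n fCs => /=; flia.
exists (t :: Cs); split=> /=; [exact: packing_cons|by rewrite sCs|].
rewrite size_cat mulSn leq_add ?st //.
by move: le_n fCs => /=; flia.
Qed.

(** The last cycle may be long, so only the weaker order condition of [cycle_avoiding] has to be met
    for it. *)
Lemma exists_packing c k : 0 < c -> 0 < k -> f k c <= #|T| ->
  exists2 Cs, packing c Cs & size Cs = k.
Proof.
case: k => // k c_gt0 _ le_n.
have sq : 2 * k <= k * k + 1 by nia.
have [|Cs [pCs sCs fCs]] := @small_packing c k c_gt0.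
  apply: leq_trans le_n; case: k sq => [|k] /= sq; first by rewrite /f -mulnn; lia.
  have {}sq : 2 * k <= k * k + 1 by nia.
  by case: (c) c_gt0 => // c' _; rewrite /f -mulnn; lia.
have [|t [ct tCs _]] := @cycle_avoiding c (flatten Cs) c_gt0 (proj2 pCs).
  apply: leq_trans (_ : 2 * (k * (4 * c + 12)) + 4 * c + 8 <= _); first by flia.
  by apply: leq_trans le_n; case: (c) c_gt0 => // c' _; rewrite /f -mulnn; lia.
by exists (t :: Cs); [exact: packing_cons|rewrite /= sCs].
Qed.

End DisjointCycles.

(** * Maximal packings *)

Section FlattenCount.
Variable T : eqType.

(** One rotation has to serve both [e] and the relation that forbids consecutive attached vertices,
    hence the quantification over [r]. *)
Lemma rot_last (x : T) s : x \in s -> exists s',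
  perm_eq (rcons s' x) s /\ forall r, cycle r (rcons s' x) = cycle r s.
Proof.
case/rot_to=> i s' def_s; exists s'.
rewrite -rot1_cons -def_s; split; first by rewrite !perm_rot.
by move=> r; rewrite !rot_cycle.
Qed.

Lemma flatten_pigeon (a b : pred T) (Ds : seq (seq T)) :
  size (flatten Ds) < count a (flatten Ds) + count b (flatten Ds) ->
  exists2 D, D \in Ds & size D < count a D + count b D.
Proof.
elim: Ds => //= D Ds IH; rewrite size_cat !count_cat => lt.
have [le|gt] := leqP (count a D + count b D) (size D); last by exists D; rewrite ?mem_head.
have [|E Ein gtE] := IH; first by lia.
by exists E => //; rewrite inE Ein orbT.
Qed.

Lemma perm_flatten_rem (C : seq T) Cs : C \in Cs ->
  perm_eq (flatten Cs) (C ++ flatten (rem C Cs)).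
Proof. by move=> CCs; apply: (perm_flatten (perm_to_rem CCs)). Qed.

Lemma size_remS (C : seq T) Cs : C \in Cs -> (size (rem C Cs)).+1 = size Cs.
Proof. by move=> CCs; rewrite (perm_size (perm_to_rem CCs)). Qed.

End FlattenCount.

Section Packing.
Variables (T : finType) (e : rel T).
Hypotheses (e_sym : symmetric e) (e_irr : irreflexive e).
Hypothesis ore : sigma2_ge e #|T|.
Variable c : nat.
Hypothesis c_gt0 : 0 < c.

(* [L] stands for the covered vertices; only the values on [L] matter. *)
Definition attached (L : seq T) x := has (e x) (outside L).

(** Second extremal quantity, maximised among the packings that cover [L]: it grows when vertices
    move from other cycles to those with attached vertices. *)
Definition touched L (Ds : seq (seq T)) :=
  sumn [seq size D | D <- Ds & has (attached L) D].

Variable Cs : seq (seq T).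
Hypothesis pack_Cs : packing e c Cs.
Hypothesis max_Cs : forall Ds, packing e c Ds -> size Ds = size Cs ->
  size (flatten Ds) <= size (flatten Cs).

Notation L := (flatten Cs).
Notation H := (outside L).
Notation att := (attached L).
Notation natt := (fun x y => ~~ (att x && att y)).

Let uL : uniq L. Proof. by case: pack_Cs. Qed.

(** * Insertion arguments and Ore's condition on the complement *)

Lemma rem_packing C : C \in Cs -> packing e c (rem C Cs).
Proof.
move=> CCs; have [cC uC] := pack_Cs; split; first by move=> D /mem_rem; apply: cC.
by move: uC; rewrite (perm_uniq (perm_flatten_rem CCs)) cat_uniq => /and3P[].
Qed.

Lemma is_cycle_in C : C \in Cs -> is_cycle e C.
Proof. by move=> CCs; case: (proj1 pack_Cs C CCs). Qed.

Lemma mem_L C x : C \in Cs -> x \in C -> x \in L.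
Proof. by move=> CCs xC; apply/flattenP; exists C. Qed.

Lemma attachedP x : reflect (exists2 u, u \in H & e x u) (att x).
Proof. exact: hasP. Qed.

(** Exchanges that keep all of [L] covered end here; [r] collects the newly covered vertices and [X]
    shows that there is one. *)
Lemma no_larger Ds X r : (forall D, D \in Ds -> c_chorded_cycle e c D) ->
  size Ds = size Cs -> perm_eq (flatten Ds) (L ++ r) -> uniq r -> {subset r <= H} ->
  X \in r -> False.
Proof.
move=> cD sD pD ur rH Xr.
have uLr : uniq (L ++ r).
  rewrite cat_uniq uL ur andbT; apply/hasPn=> x /rH.
  by rewrite mem_outside.
have := max_Cs (conj cD _) sD; rewrite (perm_uniq pD) => /(_ uLr).
rewrite (perm_size pD) size_cat; case: r {pD ur rH uLr} Xr => //= y r _; lia.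
Qed.

Lemma replace_cycle C t r x : C \in Cs -> is_cycle e t -> perm_eq t (C ++ r) ->
  uniq r -> {subset r <= H} -> x \in r -> False.
Proof.
move=> CCs ct pt ur rH xr; apply: (@no_larger (t :: rem C Cs) x r) => //.
- move=> D; rewrite inE => /predU1P[->|/mem_rem DCs]; last exact: (proj1 pack_Cs).
  have [cC chC] := proj1 pack_Cs C CCs; split=> //.
  apply: leq_trans chC _; apply: chords_mono => // y yC.
  by rewrite (perm_mem pt) mem_cat yC.
- exact: size_remS.
apply/permP=> a; rewrite /= count_cat (permP pt) !count_cat.
by rewrite (permP (perm_flatten_rem CCs)) count_cat addnAC.
Qed.

Lemma no_insertion C i x s u p : C \in Cs -> rot i C = x :: s ->
  path e u p -> uniq (u :: p) -> {subset u :: p <= H} ->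
  e (last x s) u -> e (last u p) x -> False.
Proof.
move=> CCs def_C pp up upH exu eux.
have /and3P[sC uC cC] := is_cycle_in CCs.
have [ps _] := rot_path cC def_C.
have pt : perm_eq ((x :: s) ++ u :: p) (C ++ u :: p).
  by rewrite perm_cat2r -def_C perm_rot.
apply: (@replace_cycle C ((x :: s) ++ u :: p) (u :: p) u); rewrite ?mem_head //.
apply/and3P; split.
- by rewrite (perm_size pt) size_cat ltn_addr.
- rewrite (perm_uniq pt) cat_uniq uC up andbT; apply/hasPn=> y /upH.
  by rewrite mem_outside; apply: contra; apply: mem_L.
by rewrite cat_cons cycle_consE cat_path last_cat /= ps exu pp.
Qed.

(** A larger degree exceeds half of some cycle, so [v] sees two consecutive vertices there and can
    be inserted between them. *)
Lemma half_degree v : v \in H -> (count (e v) L).*2 <= size L.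
Proof.
move=> vH; rewrite -addnn leqNgt; apply/negP=> /flatten_pigeon[C CCs].
apply/negP; rewrite -leqNgt; apply: cycle_count; apply/negPn/negP.
case/cycle_break=> i [x [s [def_C /negPn/andP[evl evx]]]].
apply: (no_insertion (u := v) (p := [::]) CCs def_C) => //=; last by rewrite e_sym.
by move=> y; rewrite mem_seq1 => /eqP->.
Qed.

Lemma ore_outside : {in H &, forall u v, u != v -> ~~ e u v ->
  size H <= count (e u) H + count (e v) H}.
Proof.
move=> u v uH vH nuv /(ore nuv); rewrite -(size_outside uL) !(deg_split e _ uL).
by move: (half_degree uH) (half_degree vH); flia.
Qed.

(** Non-adjacent vertices have a common neighbour in [H], by [ore_outside] and
    inclusion-exclusion. *)
Lemma link u v : u \in H -> v \in H -> exists p,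
  [/\ path e u p, last u p = v, uniq (u :: p) & {subset u :: p <= H}].
Proof.
move=> uH vH; have [->|nuv] := eqVneq u v.
  by exists [::]; split=> // x; rewrite mem_seq1 => /eqP->.
have [euv|neuv] := boolP (e u v).
  exists [:: v]; split; rewrite /= ?euv ?inE ?nuv //.
  by move=> x; rewrite !inE => /orP[]/eqP->.
have common : has (predI (e u) (e v)) H.
  rewrite has_count; have := count_predUI (e u) (e v) H.
  have : count (predU (e u) (e v)) H < size H.
    rewrite -(count_predC (predU (e u) (e v)) H) -[ltnLHS]addn0 ltn_add2l -has_count.
    by apply/hasP; exists u; rewrite //= e_irr e_sym (negbTE neuv).
  by move: (ore_outside uH vH nuv neuv); flia.
have [x xH /andP[/= eux evx]] := hasP common.
exists [:: x; v]; split=> //=; first by rewrite eux e_sym evx.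
  rewrite !inE negb_or nuv !andbT; apply/andP; split.
    by apply: contraTneq eux => ->; rewrite e_irr.
  by apply: contraTneq evx => ->; rewrite e_irr.
by move=> y; rewrite !inE => /or3P[]/eqP->.
Qed.

Lemma no_consecutive C : C \in Cs -> cycle natt C.
Proof.
move=> CCs; apply/negPn/negP=> /cycle_break[i [x [s [def_C /negPn/andP[]]]]].
move=> /attachedP[u uH eu] /attachedP[v vH ev].
have [p [pp lp up pH]] := link uH vH.
by apply: (no_insertion CCs def_C pp) => //; rewrite lp e_sym.
Qed.

(** [w] has no neighbour in [H] and [v] at most [size H - 1], so the rest of Ore's bound falls on
    [L]. *)
Lemma degree_sum w v : w \in L -> ~~ att w -> v \in H ->
  size L < count (e w) L + count (e v) L.
Proof.
move=> wL natw vH.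
have nwv : w != v by apply: contraTneq vH => <-; rewrite mem_outside wL.
have newv : ~~ e w v by apply: contra natw => ewv; apply/attachedP; exists v.
have := ore nwv newv; rewrite -(size_outside uL) !(deg_split e _ uL).
have -> : count (e w) H = 0.
  by apply/eqP; rewrite -leqn0 leqNgt -has_count.
by move: (count_irr e_irr vH); flia.
Qed.

Lemma attached_sum w v : w \in L -> ~~ att w -> v \in H ->
  size L < count (e w) L + count att L.
Proof.
move=> wL natw vH; apply: leq_trans (degree_sum wL natw vH) _.
rewrite leq_add2l; apply: sub_count => x evx; apply/attachedP.
by exists v; rewrite // e_sym.
Qed.

(** * Moving non-attached vertices between cycles *)

Lemma touched_perm Ds Es : perm_eq Ds Es -> touched L Ds = touched L Es.
Proof. by move=> pDE; apply: perm_sumn; apply: perm_map; apply: perm_filter. Qed.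

(** Some cycle [D] carries the excess. At most half of [D] is attached, so [w] sees more than half
    of it and fits between two consecutive neighbours. As [w] sees at most all of [D], some vertex
    of [D] is attached, and [touched] grows. *)
Lemma absorb_vertex Ds w : packing e c Ds -> (forall D, D \in Ds -> cycle natt D) ->
  w \notin flatten Ds -> ~~ att w ->
  size (flatten Ds) < count (e w) (flatten Ds) + count att (flatten Ds) ->
  exists Es, [/\ packing e c Es, forall D, D \in Es -> cycle natt D,
    size Es = size Ds, perm_eq (flatten Es) (w :: flatten Ds) &
    touched L Es = (touched L Ds).+1].
Proof.
move=> [cD uD] nD wD natw /flatten_pigeon[D DDs gtD].
have [[/and3P[sD uDD cycD] chD] nattD] := (cD D DDs, nD D DDs).
have attD : has att D.
  by rewrite has_count; move: gtD (count_size (e w) D); flia.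
have : ~~ cycle (fun x y => ~~ (e w x && e w y)) D.
  apply/negP=> /(@cycle_count _ (e w) (e w)); have := cycle_count nattD.
  by move: gtD; flia.
case/cycle_break=> i [x [s [def_D /negPn/andP[ewl ewx]]]].
have [ps _] := rot_path cycD def_D.
have [t def_t] : exists t, t = rcons (x :: s) w by exists (rcons (x :: s) w).
have pt : perm_eq t (w :: D).
  by rewrite def_t perm_rcons perm_cons -def_D perm_rot.
have pE : perm_eq (flatten (t :: rem D Ds)) (w :: flatten Ds).
  apply/permP=> a; rewrite /= count_cat (permP pt) /=.
  by rewrite (permP (perm_flatten_rem DDs)) count_cat addnA.
have ct : is_cycle e t.
  apply/and3P; split.
  - by rewrite (perm_size pt) /= ltnW.
  - rewrite (perm_uniq pt) /= uDD andbT; apply: contra wD => wD.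
    by apply/flattenP; exists D.
  - by rewrite def_t rcons_cons cycle_consE rcons_path last_rcons ps e_sym ewl.
exists (t :: rem D Ds); split=> //.
- split; last by rewrite (perm_uniq pE) /= wD.
  move=> E; rewrite inE => /predU1P[->|/mem_rem]; last exact: cD.
  split=> //; apply: leq_trans chD _; apply: chords_mono => //.
    exact/and3P.
  by move=> y yD; rewrite (perm_mem pt) inE yD orbT.
- move=> E; rewrite inE => /predU1P[->|/mem_rem]; last exact: nD.
  move: nattD; rewrite -(rot_cycle i) def_D def_t rcons_cons /= !rcons_path last_rcons.
  by move=> /andP[-> _]; rewrite (negbTE natw) andbF.
- exact: size_remS.
rewrite (touched_perm (perm_to_rem DDs)) /touched /= attD.
have -> : has att t by rewrite (perm_has _ pt) /= attD orbT.
by rewrite /= (perm_size pt).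
Qed.

(* If [w] is adjacent to the successor on the path of an attached vertex, a path
   through the complement closes [w :: s] to a cycle; otherwise the successors of
   the attached vertices are non-neighbours of [w]. *)
Lemma cross_dichotomy w s v : path e w s -> uniq (w :: s) -> 0 < size s ->
  {subset w :: s <= L} -> v \in H -> e v (last w s) ->
  (exists t r, [/\ is_cycle e t, perm_eq t ((w :: s) ++ r), uniq r,
     {subset r <= H} & v \in r]) \/
  (~~ att w /\ count (e w) (w :: s) + count att (w :: s) <= size (w :: s)).
Proof.
move=> ps us s_gt0 sL vH evl.
have cycleP t r : cycle e t -> perm_eq t ((w :: s) ++ r) -> uniq r ->
    {subset r <= H} -> v \in r -> is_cycle e t.
  move=> ct pt ur rH vr; apply/and3P; split=> //.
    rewrite (perm_size pt) size_cat /=; case: r vr {pt ur rH} => //= *; flia.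
  rewrite (perm_uniq pt) cat_uniq us ur andbT; apply/hasPn=> x /rH.
  by rewrite mem_outside; apply: contra; apply: sL.
have [/attachedP[u uH ewu]|natw] := boolP (att w).
  left; have [p [pp lp up pH]] := link vH uH.
  exists ((w :: s) ++ v :: p), (v :: p); rewrite mem_head; split=> //.
  apply: (cycleP _ (v :: p)); rewrite ?mem_head //.
  by rewrite cat_cons cycle_consE cat_path last_cat /= ps lp e_sym evl pp e_sym.
have [ok|] := boolP (path (fun x y => ~~ (att x && e w y)) w s).
  right; split=> //; have := path_count ok.
  have -> : count att (w :: s) = count att (belast w s) + att (last w s).
    by rewrite lastI -cats1 count_cat /= addn0.
  by rewrite /= e_irr; case: (att _) => /=; flia.
case/path_break=> s1 [y [s2 [def_s /negPn/andP[/attachedP[u uH elu] ewy]]]].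
have [p [pp lp up pH]] := link uH vH.
have def_ws : w :: s = belast w s1 ++ last w s1 :: y :: s2.
  by rewrite -[RHS]cat_rcons -lastI def_s.
left; exists (belast w s1 ++ last w s1 :: (u :: p) ++ rev (y :: s2)), (u :: p).
have pt : perm_eq (belast w s1 ++ last w s1 :: (u :: p) ++ rev (y :: s2))
                  ((w :: s) ++ u :: p).
  rewrite def_ws; apply/permP=> a.
  by rewrite !count_cat /= !count_cat !count_rev /=; flia.
have vp : v \in u :: p by rewrite -lp mem_last.
split=> //; apply: (cycleP _ (u :: p)) => //.
by apply: (cross_cycle e_sym ps) => //; rewrite /= rcons_path elu pp lp.
Qed.

(* [w :: s] is what remains of a cycle whose first vertices were moved to the
   cycles [Ds]; the many neighbours of [v] on it guarantee enough chords. *)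
Lemma absorb_path v s Ds w : packing e c Ds -> (forall D, D \in Ds -> cycle natt D) ->
  (size Ds).+1 = size Cs -> perm_eq (flatten Ds ++ w :: s) L -> path e w s ->
  v \in H -> e v (last w s) -> c + 2 <= count (e v) (w :: s) -> False.
Proof.
elim: s Ds w => [|w' s IH] Ds w pDs nD sD pL ps vH evl degv.
  by move: degv; rewrite /=; case: (e v w) => /=; flia.
have uDs : uniq (flatten Ds ++ w :: w' :: s) by rewrite (perm_uniq pL).
have us : uniq (w :: w' :: s) by move: uDs; rewrite cat_uniq => /and3P[].
have sL : {subset w :: w' :: s <= L}.
  by move=> x xs; rewrite -(perm_mem pL) mem_cat xs orbT.
have [[t [r [ct pt ur rH vr]]]|[natw le_w]] := cross_dichotomy ps us isT sL vH evl.
  apply: (@no_larger (t :: Ds) v r) => //.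
  - move=> D; rewrite inE => /predU1P[->|]; last exact: (proj1 pDs).
    split=> //; apply: (chords_deg ct (v := v)).
      by rewrite (perm_mem pt) mem_cat vr orbT.
    by rewrite (permP pt) count_cat (leq_trans degv) ?leq_addr.
  apply/permP=> a; rewrite /= count_cat (permP pt) !count_cat -(permP pL) count_cat.
  by flia.
have wL : w \in L by apply: sL; rewrite mem_head.
(* On [w :: w' :: s] the two counts total at most the length, so the excess from [attached_sum] lies
   on [Ds]. *)
have [||Es [pEs nE sE pE _]] := absorb_vertex pDs nD _ natw.
- move: uDs; rewrite cat_uniq => /and3P[_ /hasPn nDs _]; apply: nDs.
  exact: mem_head.
- move: (attached_sum wL natw vH) le_w.
  by rewrite -!(permP pL) -(perm_size pL) size_cat !count_cat; flia.
apply: (IH Es w') => //.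
- by rewrite sE.
- apply: perm_trans pL; apply/permP=> a.
  by rewrite count_cat (permP pE) !count_cat /=; flia.
- by case/andP: ps.
have newv : e v w = false.
  by apply: contraNF natw => evw; apply/attachedP; exists v; rewrite // e_sym.
by move: degv; rewrite /= newv.
Qed.

(** Otherwise [C], opened just after a neighbour of [v], meets the conditions of [absorb_path]. *)
Lemma few_neighbours C v : C \in Cs -> v \in H -> count (e v) C <= c + 1.
Proof.
move=> CCs vH; rewrite leqNgt; apply/negP=> degv.
have /hasP[y yC evy] : has (e v) C by rewrite has_count; flia.
have [s [ps cs]] := rot_last yC.
have /and3P[sC _ cC] := is_cycle_in CCs.
case: s ps cs => [|w s] ps cs; first by rewrite -(perm_size ps) in sC.
have := cs e; rewrite cC rcons_cons cycle_consE => /andP[pws _].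
apply: (@absorb_path v (rcons s y) (rem C Cs) w) => //.
- exact: rem_packing.
- by move=> D /mem_rem; apply: no_consecutive.
- exact: size_remS.
- apply/permP=> a; rewrite (permP (perm_flatten_rem CCs)) !count_cat.
  by rewrite -(permP ps) rcons_cons addnC.
- by rewrite last_rcons.
- by rewrite -rcons_cons (permP ps); flia.
Qed.

(** Opened just after [y], [C] either takes in vertices of [H], against maximality, or leaves the
    excess of [attached_sum] to the other cycles; a cycle with excess has an attached vertex. *)
Lemma second_attached C : C \in Cs -> has att C ->
  exists2 D, D \in rem C Cs & has att D.
Proof.
move=> CCs /hasP[y yC /attachedP[v vH eyv]].
have [s [ps cs]] := rot_last yC.
have /and3P[sC uC cC] := is_cycle_in CCs.
case: s ps cs => [|w s] ps cs; first by rewrite -(perm_size ps) in sC.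
have := cs e; rewrite cC rcons_cons cycle_consE => /andP[pws _].
rewrite rcons_cons in ps.
have sL : {subset w :: rcons s y <= L}.
  by move=> x; rewrite (perm_mem ps); apply: mem_L.
have [|||[t [r [ct pt ur rH vr]]]|[natw le_w]] := cross_dichotomy pws _ _ sL vH.
- by rewrite (perm_uniq ps).
- by rewrite size_rcons.
- by rewrite last_rcons e_sym.
- case: (@replace_cycle C t r v) => //; apply: (perm_trans pt).
  by rewrite perm_cat2r.
have wL : w \in L by apply: sL; rewrite mem_head.
have [|D DCs gtD] := @flatten_pigeon _ (e w) att (rem C Cs).
  move: (attached_sum wL natw vH) le_w; rewrite !(permP ps) (perm_size ps).
  rewrite !(permP (perm_flatten_rem CCs)) (perm_size (perm_flatten_rem CCs)).
  by rewrite size_cat !count_cat; flia.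
by exists D => //; rewrite has_count; move: gtD (count_size (e w) D); flia.
Qed.

(** * Sizes of the parts *)

Notation K := (size Cs * (c + 1)).

(** [K] bounds the neighbours of [v] in [L], at most [c + 1] on each cycle; [degree_sum] turns this
    into a bound on the non-neighbours of [w]. *)
Lemma few_strangers w s v : w \in L -> ~~ att w -> v \in H ->
  uniq s -> {subset s <= L} -> count (predC (e w)) s < K.
Proof.
move=> wL natw vH us sL.
have degv : count (e v) L <= K.
  by rewrite count_flatten; apply: sumn_le => C CCs; apply: few_neighbours.
apply: (@leq_ltn_trans (count (predC (e w)) L)).
  by apply: subset_count => // x /sL.
by move: (degree_sum wL natw vH) (count_predC (e w) L) degv; flia.
Qed.

(* Otherwise [C] can be cut into a short chorded cycle and a path; the latter
   forms one cycle together with a second cycle that has attached vertices and a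
   path in the complement. *)
Lemma attached_small C : C \in Cs -> has att C -> size C < 3 * K + c.
Proof.
move=> CCs attC; rewrite ltnNge; apply/negP=> big.
have [D DCs attD] := second_attached CCs attC.
have DinCs := mem_rem DCs.
have /hasP[y yD /attachedP[u uH eyu]] := attD.
have /hasP[y' yC /attachedP[u' uH' eyu']] := attC.
have [sC [pC cycC]] := rot_last yC.
have [sD [pD cycD]] := rot_last yD.
have /and3P[gtC uC cC] := is_cycle_in CCs.
have /and3P[gtD uD cD] := is_cycle_in DinCs.
have atty : att y by apply/attachedP; exists u.
have atty' : att y' by apply/attachedP; exists u'.
case: sC pC cycC => [|x1 sC] pC cycC; first by rewrite -(perm_size pC) in gtC.
case: sD pD cycD => [|b sD] pD cycD; first by rewrite -(perm_size pD) in gtD.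
rewrite rcons_cons in pC; rewrite rcons_cons in pD.
have := cycC e; rewrite cC rcons_cons cycle_consE => /andP[pathC _].
have := cycD e; rewrite cD rcons_cons cycle_consE => /andP[pathD _].
have natx : ~~ att x1.
  have := cycC natt; rewrite (no_consecutive CCs) /= rcons_path.
  by rewrite last_rcons atty' => /andP[].
have natb : ~~ att b.
  have := cycD natt; rewrite (no_consecutive DinCs) /= rcons_path.
  by rewrite last_rcons atty => /andP[].
set s := x1 :: rcons sC y' in pC.
have us : uniq s by rewrite (perm_uniq pC).
have sL : {subset s <= L} by move=> x; rewrite (perm_mem pC); apply: mem_L.
have xL : x1 \in L by apply: sL; rewrite mem_head.
have bL : b \in L by apply: (mem_L DinCs); rewrite -(perm_mem pD) mem_head.
have K_gt0 : 0 < K by rewrite muln_gt0 addn1 andbT; case: (Cs) CCs.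
(* A cycle that extends [S0] contains at least [c + 2] neighbours of [x1], and [S] keeps the [2 K]
   vertices that [adjacent_pair] requires. *)
pose S0 := take (K + c) s; pose S := drop (K + c) s.
have def_s : s = S0 ++ S by rewrite cat_take_drop.
have subS : {subset S <= L} by move=> x /mem_drop/sL.
have uS : uniq S by rewrite drop_uniq.
have [|||S1 [x [z [S2 [def_S ax bz]]]]] := @adjacent_pair _ (e x1) (e b) K.-1 S.
- by rewrite -ltnS prednK // (few_strangers xL natx uH).
- by rewrite -ltnS prednK // (few_strangers bL natb uH).
- by rewrite size_drop (perm_size pC); move: big K_gt0; flia.
have sS0 : size S0 = K + c.
  by rewrite size_takel // (perm_size pC); move: big; flia.
have [X' def_X] : exists X', x1 :: X' = S0 ++ rcons S1 x.
  case: (S0) sS0 def_s => [|x2 S0'] /= sS0; first by move: K_gt0 sS0; flia.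
  by case=> -> _; exists (S0' ++ rcons S1 x).
have def_s' : s = (x1 :: X') ++ z :: S2.
  by rewrite def_X -catA cat_rcons -def_S.
have def_C : rcons sC y' = X' ++ z :: S2 by case: def_s'.
have lastX : last x1 X' = x.
  by rewrite -(last_cons x1 x1) def_X last_cat last_rcons.
have lastZ : last z S2 = y'.
  by rewrite -(last_rcons x1 sC y') def_C last_cat.
move: pathC; rewrite def_C cat_path => /= /and3P[pathX _ pathZ].
have [p [pp lp up pH]] := link uH uH'.
have cX : c_chorded_cycle e c (x1 :: X').
  have sX : K + c < size (x1 :: X').
    by rewrite def_X size_cat size_rcons sS0; flia.
  have uX : uniq (x1 :: X') by move: us; rewrite def_s' cat_uniq => /and3P[].
  have isX : is_cycle e (x1 :: X').
    apply/and3P; split=> //; first by move: sX c_gt0 K_gt0; flia.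
    by rewrite cycle_consE pathX lastX e_sym.
  split=> //; apply: (chords_deg isX (v := x1)); rewrite ?mem_head //.
  have := count_predC (e x1) (x1 :: X').
  have XL : {subset x1 :: X' <= L} by move=> x2 x2X; apply: sL; rewrite def_s' mem_cat x2X.
  by move: sX (few_strangers xL natx uH uX XL); flia.
(* [t] runs along [D] from [b] to [y], through [H] from [u] to [u'], then backwards along the tail
   of [C] from [y'] to [z], which is adjacent to [b]. *)
have [t def_t] : exists t, t = (b :: rcons sD y) ++ (u :: p) ++ rev (z :: S2) by eexists.
have ct : cycle e t.
  rewrite def_t rev_consE cat_cons cycle_consE cat_path last_cat /= pathD last_rcons eyu.
  rewrite cat_path last_cat pp lp /= path_rev // pathZ last_rev_belast lastZ.
  by rewrite e_sym eyu' e_sym bz.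
pose F := flatten (rem D (rem C Cs)).
have pL : perm_eq L (s ++ (b :: rcons sD y) ++ F).
  apply/permP=> a; rewrite (permP (perm_flatten_rem CCs)) count_cat.
  rewrite (permP (perm_flatten_rem DCs)) !count_cat.
  by rewrite (permP pC) (permP pD).
have pN : perm_eq (flatten [:: x1 :: X', t & rem D (rem C Cs)]) (L ++ u :: p).
  apply/permP=> a; rewrite [flatten _]/= -cat_cons !count_cat (permP pL) def_t.
  by rewrite def_s' !count_cat count_rev -/F; flia.
have uN : uniq (flatten [:: x1 :: X', t & rem D (rem C Cs)]).
  rewrite (perm_uniq pN) cat_uniq uL up andbT; apply/hasPn=> x2 /pH.
  by rewrite mem_outside.
apply: (@no_larger [:: x1 :: X', t & rem D (rem C Cs)] u (u :: p)) => //.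
- move=> E; rewrite !inE => /or3P[/eqP->|/eqP->|ECs] //; last first.
    by apply: (proj1 pack_Cs); apply/mem_rem/(mem_rem ECs).
  have [isD chD] := proj1 pack_Cs D DinCs.
  have ist : is_cycle e t.
    apply/and3P; split=> //.
      by rewrite def_t size_cat (perm_size pD); move: gtD; flia.
    have : uniq ((x1 :: X') ++ t ++ F) := uN.
    by rewrite cat_uniq => /and3P[_ _]; rewrite cat_uniq => /and3P[].
  split=> //; apply: leq_trans chD _; apply: chords_mono => // x2.
  by rewrite -(perm_mem pD) def_t mem_cat => ->.
- by rewrite /= size_remS // size_remS.
- exact: mem_head.
Qed.

(** No vertex of [X] or [R] is attached, so for each [w] in [R] the excess of [attached_sum] lies on
    [Ds], and each absorption adds one to [touched]. *)
Lemma absorb_all X R Ds v : c_chorded_cycle e c X -> ~~ has att X ->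
  packing e c Ds -> (forall D, D \in Ds -> cycle natt D) -> v \in H ->
  perm_eq (X ++ flatten Ds ++ R) L -> ~~ has att R ->
  exists Es, [/\ packing e c (X :: Es), size Es = size Ds,
    perm_eq (flatten (X :: Es)) L & touched L Es = touched L Ds + size R].
Proof.
move=> cX nattX; elim: R Ds => [|w R IH] Ds pDs nD vH pL nattR.
  rewrite cats0 in pL; exists Ds; split; rewrite ?addn0 //.
  split; last by rewrite (perm_uniq pL).
  by move=> E; rewrite inE => /predU1P[->|]; last exact: (proj1 pDs).
have [natw {}nattR] : ~~ att w /\ ~~ has att R by move: nattR; rewrite /= negb_or => /andP.
have uLs : uniq (X ++ flatten Ds ++ w :: R) by rewrite (perm_uniq pL).
have wL : w \in L by rewrite -(perm_mem pL) !mem_cat mem_head !orbT.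
have [||Es [pEs nE sE pE tE]] := absorb_vertex pDs nD _ natw.
- move: uLs; rewrite catA cat_uniq => /and3P[_ /hasPn/(_ w (mem_head _ _)) wDs _].
  by apply: contra wDs => wDs; rewrite mem_cat wDs orbT.
- have noatt s : ~~ has att s -> count att s = 0 by rewrite has_count -leqNgt leqn0 => /eqP.
  have := attached_sum wL natw vH.
  rewrite -!(permP pL) -(perm_size pL) !size_cat !count_cat (noatt _ nattX) /=.
  rewrite (negbTE natw) (noatt _ nattR) e_irr.
  by move: (count_size (e w) X) (count_size (e w) R); flia.
have [|Fs [pFs sF pF tF]] := IH Es pEs nE vH _ nattR.
  apply: perm_trans pL; apply/permP=> a.
  by rewrite !count_cat (permP pE) /=; flia.
by exists Fs; split; rewrite ?sF // tF tE /= addSnnS.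
Qed.

Hypothesis max_touched : forall Ds, packing e c Ds -> size Ds = size Cs ->
  perm_eq (flatten Ds) L -> touched L Ds <= touched L Cs.

(** A long [C] is cut down to a shorter chorded cycle as in [attached_small]; its other vertices go
    to cycles with attached vertices, which raises [touched]. *)
Lemma unattached_small C v : v \in H -> C \in Cs -> ~~ has att C -> size C < 3 * K + c.
Proof.
move=> vH CCs nattC; rewrite ltnNge; apply/negP=> big.
have [isC _] := proj1 pack_Cs C CCs; have /and3P[gtC uC cC] := isC.
case def_C: C gtC => [//|x1 sC] _.
have K_gt0 : 0 < K by rewrite muln_gt0 addn1 andbT; case: (Cs) CCs.
have K_gt1 : 1 < K by move: K_gt0; case: (size Cs) => //; move: c_gt0; flia.
have CL : {subset C <= L} by move=> x; apply: mem_L.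
have natx : ~~ att x1 by apply: contra nattC => ax; rewrite def_C /= ax.
have xL : x1 \in L by apply: CL; rewrite def_C mem_head.
pose S0 := take (K + c) C; pose S := drop (K + c) C.
have def_CS : C = S0 ++ S by rewrite cat_take_drop.
have [|||S1 [x [z [S2 [def_S ax _]]]]] := @adjacent_pair _ (e x1) predT K.-1 S.
- rewrite -ltnS prednK // (few_strangers xL natx vH) ?drop_uniq //.
  by move=> y /mem_drop/CL.
- by rewrite (@eq_count _ _ pred0) // count_pred0.
- by rewrite size_drop; move: big K_gt0; flia.
have sS0 : size S0 = K + c.
  by rewrite size_takel //; move: big; flia.
have [X' def_X] : exists X', x1 :: X' = S0 ++ rcons S1 x.
  case: (S0) sS0 def_CS => [|x2 S0'] /= sS0; first by move: K_gt0 sS0; flia.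
  by rewrite def_C; case=> -> _; exists (S0' ++ rcons S1 x).
have def_C' : C = (x1 :: X') ++ z :: S2.
  by rewrite def_X -catA cat_rcons -def_S.
have lastX : last x1 X' = x.
  by rewrite -(last_cons x1 x1) def_X last_cat last_rcons.
have pathX : path e x1 X'.
  by move: cC; rewrite def_C' cat_cons cycle_consE cat_path => /andP[/andP[]].
have cX : c_chorded_cycle e c (x1 :: X').
  have sX : K + c < size (x1 :: X').
    by rewrite def_X size_cat size_rcons sS0; flia.
  have uX : uniq (x1 :: X') by move: uC; rewrite def_C' cat_uniq => /and3P[].
  have isX : is_cycle e (x1 :: X').
    apply/and3P; split=> //; first by move: sX c_gt0 K_gt0; flia.
    by rewrite cycle_consE pathX lastX e_sym.
  split=> //; apply: (chords_deg isX (v := x1)); rewrite ?mem_head //.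
  have := count_predC (e x1) (x1 :: X').
  have XL : {subset x1 :: X' <= L} by move=> y yX; apply: CL; rewrite def_C' mem_cat yX.
  by move: sX (few_strangers xL natx vH uX XL); flia.
have [nattX nattZ] : ~~ has att (x1 :: X') /\ ~~ has att (z :: S2).
  by move: nattC; rewrite def_C' has_cat negb_or => /andP.
have [|||Es [pEs sE pE tE]] := @absorb_all _ (z :: S2) (rem C Cs) v cX nattX _ _ vH _ nattZ.
- exact: rem_packing.
- by move=> D /mem_rem; apply: no_consecutive.
- apply/permP=> a; rewrite (permP (perm_flatten_rem CCs)) count_cat {2}def_C'.
  by rewrite !count_cat; flia.
have := max_touched pEs _ pE; rewrite /= sE size_remS // => /(_ erefl).
rewrite (touched_perm (perm_to_rem CCs)) /touched /= (negbTE nattC).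
move: nattX; rewrite /= => /negbTE->.
by move: tE; rewrite /touched => ->; rewrite /=; flia.
Qed.

(** Otherwise a Hamiltonian cycle of [H] is longer than [C] and can take its place, the vertices of
    [C] being given up. *)
Lemma outside_small C : C \in Cs -> size C < 3 * K + c -> size H < 3 * K + c.
Proof.
move=> CCs small; rewrite ltnNge; apply/negP=> big.
have K_ge : c + 1 <= K by rewrite leq_pmull //; case: (Cs) CCs.
have [|t ist pt] := ore_hamilton e_sym e_irr (outside_uniq L) _ ore_outside.
  by move: big; flia.
have ct : c_chorded_cycle e c t.
  split=> //; suff [v vH degv] : exists2 v, v \in H & c + 2 <= count (e v) H.
    by apply: (chords_deg ist (v := v)); rewrite ?(perm_mem pt) // (permP pt).
  (* Either [H] is complete, or one of two non-adjacent vertices has at least [c + 2] neighbours in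
     [H] by [ore_outside]. *)
  have [clique|] := boolP (all (fun u => all (fun v => (u == v) || e u v) H) H).
    case def_H: H big => [|u s] big; first by move: big c_gt0 => /=; flia.
    exists u; first exact: mem_head.
    have uH : u \in H by rewrite def_H mem_head.
    have us : u \notin s by have := outside_uniq L; rewrite def_H => /andP[].
    have : all (e u) s.
      apply/allP=> v vs; have vH : v \in H by rewrite def_H inE vs orbT.
      have := allP (allP clique u uH) v vH.
      by have [uv|] := eqVneq u v; first by rewrite uv vs in us.
    rewrite all_count => /eqP cs; rewrite /= cs.
    by move: big K_ge c_gt0; rewrite /=; flia.
  case/allPn=> u uH /allPn[v vH]; rewrite negb_or => /andP[nuv neuv].
  have := ore_outside uH vH nuv neuv.
  have [le_u _|lt_u le_H] := leqP (c + 2) (count (e u) H); first by exists u.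
  by exists v => //; move: big K_ge c_gt0 lt_u le_H; flia.
have := @max_Cs (t :: rem C Cs) _ _.
rewrite (perm_size (perm_flatten_rem CCs)) /= !size_cat (perm_size pt) size_remS //.
have pN : packing e c (t :: rem C Cs).
  apply: packing_cons (rem_packing CCs) _ => // x; rewrite (perm_mem pt) mem_outside.
  by apply: contra; rewrite (perm_mem (perm_flatten_rem CCs)) mem_cat orbC => ->.
by move=> /(_ pN erefl); move: small big; flia.
Qed.

End Packing.

(** * Assembly of the partition *)

Lemma uniq_flatten_disjoint (T : finType) (Cs : seq (seq T)) i j :
  uniq (flatten Cs) -> i < j < size Cs -> [disjoint nth [::] Cs i & nth [::] Cs j].
Proof.
elim: Cs i j => [|C Cs IH] [|i] [|j] //=; first by rewrite andbF.
  rewrite cat_uniq => /and3P[_ /hasPn dis _] jCs.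
  rewrite disjoint_sym disjoint_subset; apply/subsetP=> x xj; rewrite inE.
  by apply: dis; apply/flattenP; exists (nth [::] Cs j); rewrite ?mem_nth.
by rewrite cat_uniq => /and3P[_ _ uCs] ij; apply: IH.
Qed.

Theorem theorem1 (k c : nat) (T : finType) (e : rel T) :
  0 < k -> 0 < c ->
  simple_graph e ->
  f k c <= #|T| ->
  sigma2_ge e #|T| ->
  exists Cs : seq (seq T),
    [/\ size Cs = k,
        (forall C, C \in Cs -> c_chorded_cycle e c C),
        (forall i j, i < size Cs -> j < size Cs -> i != j ->
           [disjoint (nth [::] Cs i) & (nth [::] Cs j)]) &
        (forall v : T, exists2 C, C \in Cs & v \in C)].
Proof.
move=> k_gt0 c_gt0 [e_sym e_irr] le_n ore.
have [Cs0 pCs0 sCs0] := exists_packing e_sym e_irr ore c_gt0 k_gt0 le_n.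
(* Lexicographic extremal choice: first the number of covered vertices, then [touched] among the
   packings that cover the same set. *)
pose P Ds := packing e c Ds /\ size Ds = k.
have [|Ds [[_ uDs] _]|Cs1 [pCs1 sCs1] max1] :=
  @exists_max _ P (fun Ds => size (flatten Ds)) #|T| Cs0; first by [].
  by rewrite -(card_uniqP uDs) max_card.
pose Q Ds := P Ds /\ perm_eq (flatten Ds) (flatten Cs1).
have [||Cs [[pCs sCs] pfCs] max2] :=
    @exists_max _ Q (touched e (flatten Cs1)) #|T| Cs1.
- by [].
- move=> Ds [[[_ uDs] _] _]; apply: (@leq_trans (size (flatten Ds))).
    rewrite /touched size_flatten /shape; elim: (Ds) => //= D Es IH.
    by case: ifP => _ /=; move: IH; flia.
  by rewrite -(card_uniqP uDs) max_card.
(* [outside] filters a fixed enumeration, so equal covered sets give equal lists and the same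
   attached vertices. *)
have eqO : outside (flatten Cs) = outside (flatten Cs1).
  by apply: eq_filter => x; rewrite (perm_mem pfCs).
have max_Cs Ds : packing e c Ds -> size Ds = size Cs -> size (flatten Ds) <= size (flatten Cs).
  by move=> pDs sDs; rewrite (perm_size pfCs); apply: max1; split; rewrite // sDs.
have max_touched Ds : packing e c Ds -> size Ds = size Cs ->
    perm_eq (flatten Ds) (flatten Cs) ->
    touched e (flatten Cs) Ds <= touched e (flatten Cs) Cs.
  move=> pDs sDs pfDs; rewrite /touched /attached eqO; apply: max2; split.
    by split; rewrite // sDs.
  exact: perm_trans pfDs pfCs.
have out0 : outside (flatten Cs) = [::].
  case def_H: (outside (flatten Cs)) => [//|v s]; exfalso.
  have vH : v \in outside (flatten Cs) by rewrite def_H mem_head.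
  pose M := 3 * (k * (c + 1)) + c.
  have small C : C \in Cs -> size C < M.
    move=> CCs; rewrite /M -sCs.
    have [attC|nattC] := boolP (has (attached e (flatten Cs)) C).
      exact: (attached_small e_sym e_irr ore c_gt0 pCs max_Cs CCs attC).
    exact: (unattached_small e_sym e_irr ore c_gt0 pCs max_Cs max_touched vH CCs nattC).
  have [C CCs] : exists C, C \in Cs.
    by case: (Cs) sCs => [|C Es] sCs; [rewrite -sCs in k_gt0|exists C; rewrite mem_head].
  have ltH : size (outside (flatten Cs)) < M.
    rewrite /M -sCs; apply: (outside_small e_sym e_irr ore c_gt0 pCs max_Cs CCs).
    by rewrite sCs; apply: small.
  have leL : size (flatten Cs) <= k * M.
    by rewrite size_flatten -sCs; apply: sumn_le => D /small/ltnW.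
  (* The [k] cycles and the complement each have fewer than [M] vertices, while [k.+1 * M] is at
     most [f k c]. *)
  move: le_n; apply/negP; rewrite -ltnNge -(size_outside (proj2 pCs)).
  apply: (@leq_trans (k.+1 * M)); first by rewrite mulSn addnC -addSn leq_add.
  have sq : k <= k * k by rewrite leq_pmulr.
  by rewrite /M /f -mulnn; case: (c) c_gt0 => // c' _; lia.
exists Cs; split=> //; first exact: (proj1 pCs).
- move=> i j iCs jCs; rewrite neq_ltn => /orP[lt_ij|lt_ji].
    by apply: uniq_flatten_disjoint; [exact: (proj2 pCs)|rewrite lt_ij].
  by rewrite disjoint_sym; apply: uniq_flatten_disjoint; [exact: (proj2 pCs)|rewrite lt_ji].
move=> v; have : v \notin outside (flatten Cs) by rewrite out0.
by rewrite mem_outside negbK => /flattenP[C CCs vC]; exists C.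
Qed.
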